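(* Let $A,B\in\mathcal{M}_n^+$. Then $$\frac{1}{8}(A-B)(A\nabla B)^{-1}(A-B)\;\le\; A\nabla B-A\sharp B\;\le\;\frac{1}{8}(A-B)(A\sharp B)^{-1}(A-B).$$
   Context: $\mathcal{M}_n^+$ denotes the set of positive (definite) $n\times n$ complex matrices: $A\in\mathcal{M}_n^+$ iff $\langle Ax,x\rangle>0$ for all nonzero $x\in\mathbb{C}^n$. For Hermitian matrices, $X\le Y$ means that $Y-X$ is positive semidefinite. For $A,B\in\mathcal{M}_n^+$, the arithmetic mean is $A\nabla B=\frac{A+B}{2}$ and the geometric mean is $A\sharp B=A^{1/2}\left(A^{-1/2}BA^{-1/2}\right)^{1/2}A^{1/2}$. *)

(* Defs.v *)
From HB Require Import structures.
From mathcomp Require Import all_boot all_order all_algebra.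
From mathcomp Require Import sesquilinear spectral.
From mathcomp Require Import complex reals.

Set Implicit Arguments.
Unset Strict Implicit.
Unset Printing Implicit Defensive.

Import Order.TTheory GRing.Theory Num.Theory.

Local Open Scope ring_scope.

Section PositiveMatrices.
Variable (C : numClosedFieldType).

(* [dotmx] is the standard inner product on row vectors, linear on the left
   and conjugate-linear on the right. *)
Definition inner n (u v : 'cV[C]_n) : C := dotmx u^T v^T.

(* In the order of [C], [0 < z] and [0 <= z] entail that [z] is real, so both
   predicates below imply that [A] is Hermitian. *)
Definition posdefmx n (A : 'M[C]_n) : Prop :=
  forall x : 'cV[C]_n, x != 0 -> 0 < inner (A *m x) x.

Definition possemidefmx n (A : 'M[C]_n) : Prop :=
  forall x : 'cV[C]_n, 0 <= inner (A *m x) x.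

Definition loewner_le n (X Y : 'M[C]_n) : Prop := possemidefmx (Y - X).

(* Functional calculus: [A = invmx P *m diag_mx d *m P] with [P := spectralmx A]
   unitary and [d := spectral_diag A] the eigenvalues, whenever [A] is normal.
   For [A] positive semidefinite this is its positive semidefinite square
   root; [sqrtC] is the nonnegative root on nonnegative elements. *)
Definition sqrtmx n (A : 'M[C]_n) : 'M[C]_n :=
  invmx (spectralmx A) *m diag_mx (map_mx sqrtC (spectral_diag A))
    *m spectralmx A.

Definition arith_mean n (A B : 'M[C]_n) : 'M[C]_n := 2^-1 *: (A + B).

Definition geom_mean n (A B : 'M[C]_n) : 'M[C]_n :=
  let S := sqrtmx A in
  S *m sqrtmx (invmx S *m B *m invmx S) *m S.

End PositiveMatrices.

(* Main.v *)
(* Put S = A^(1/2), T = S^-1 B S^-1 and diagonalize T = P^* diag(h^2) P with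
   P unitary and h > 0.  With W = P S, all the matrices involved are
   simultaneously congruent to diagonal ones: A = W^* W, B = W^* diag(h^2) W and
   A # B = W^* diag(h) W.  The two inequalities thus reduce to scalar ones for
   the pair (1, h^2), where the differences of the two sides are
   (1 - h)^4 / (4 (1 + h^2)) and (1 - h)^4 / (8 h). *)

Require Import Defs.
From mathcomp Require Import all_boot all_order all_algebra.
From mathcomp Require Import sesquilinear spectral.
From mathcomp Require Import complex reals.
From mathcomp Require Import ring.

Import Order.TTheory GRing.Theory Num.Theory.
Local Open Scope ring_scope.

Section Congruence.
Set Implicit Arguments.
Unset Strict Implicit.

Variable C : numClosedFieldType.
Local Open Scope sesquilinear_scope.

Lemma trmxC_mul m n p (A : 'M[C]_(m, n)) (B : 'M[C]_(n, p)) :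
  (A *m B) ^t* = B ^t* *m A ^t*.
Proof. by rewrite trmx_mul map_mxM. Qed.

Lemma innerE n (A : 'M[C]_n) (x : 'cV[C]_n) :
  inner (A *m x) x = (x ^t* *m A *m x) 0 0.
Proof.
rewrite /inner dotmxE trmxK -mulmxA !mxE.
by apply: eq_bigr => i _; rewrite !mxE mulrC.
Qed.

Lemma form_delta n (A : 'M[C]_n) (i j : 'I_n) :
  ((delta_mx i (0 : 'I_1)) ^t* *m A *m delta_mx j (0 : 'I_1)) 0 0 = A i j.
Proof.
have -> : (delta_mx i (0 : 'I_1)) ^t* = delta_mx 0 i :> 'M[C]_(1, n).
  by apply/matrixP => k l; rewrite !mxE andbC; case: (_ && _);
     rewrite ?conjC1 ?conjC0.
by rewrite -rowE -colE !mxE.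
Qed.

(* Polarization along the vectors e_i + e_j and e_i + 'i e_j. *)
Lemma form_eq0 n (A : 'M[C]_n) :
  (forall x : 'cV[C]_n, (x ^t* *m A *m x) 0 0 = 0) -> A = 0.
Proof.
move=> A0; apply/matrixP => i j; rewrite mxE.
have pol (c : C) : c * A i j + c^* * A j i = 0.
  pose u : 'cV[C]_n := delta_mx i 0; pose v : 'cV[C]_n := delta_mx j 0.
  have := A0 (u + c *: v).
  have -> : (u + c *: v) ^t* = u ^t* + c^* *: v ^t*.
    by apply/matrixP => k l; rewrite !mxE rmorphD rmorphM.
  rewrite !mulmxDl !mulmxDr -!scalemxAl -!scalemxAr.
  have addE (X Y : 'M[C]_1) : (X + Y) 0 0 = X 0 0 + Y 0 0 by rewrite mxE.
  have scaleE a (X : 'M[C]_1) : (a *: X) 0 0 = a * X 0 0 by rewrite mxE.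
  by rewrite !(addE, scaleE) !A0 !form_delta !(mulr0, add0r, addr0).
(* With [c = 1] the two entries are opposite; with [c = 'i] they are then forced to vanish. *)
have := pol 1; rewrite conjC1 !mul1r => /eqP; rewrite addr_eq0 => /eqP Aij.
have := pol 'i; rewrite conjCi Aij mulrN mulNr -opprD => /eqP.
rewrite oppr_eq0 -mulrDl mulf_eq0 -mulr2n mulrn_eq0 /= (negPf (neq0Ci C)).
by move/eqP ->; rewrite oppr0.
Qed.

(** Being positive in [C] includes being real, so the form of [A] equals its own conjugate, which is
    the form of the adjoint. The difference has zero form and vanishes by polarization. *)
Lemma posdefmx_hermitian n (A : 'M[C]_n) : posdefmx A -> A ^t* = A.
Proof.
move=> Apos; apply/eqP; rewrite -subr_eq0; apply/eqP/form_eq0 => x.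
have subE (X Y : 'M[C]_1) : (X - Y) 0 0 = X 0 0 - Y 0 0 by rewrite !mxE.
rewrite mulmxBr mulmxBl subE.
have -> : x ^t* *m A ^t* *m x = (x ^t* *m A *m x) ^t*.
  by rewrite !trmxC_mul trmxCK mulmxA.
rewrite [X in X - _]mxE [X in X^* - _]mxE.
suff /CrealP -> : (x ^t* *m A *m x) 0 0 \is Num.real by rewrite subrr.
have [->|/Apos] := eqVneq x 0; first by rewrite mulmx0 mxE real0.
by rewrite innerE => /gtr0_real.
Qed.

Lemma posdefmx_congr n (A M : 'M[C]_n) :
  M \in unitmx -> posdefmx A -> posdefmx (M ^t* *m A *m M).
Proof.
move=> Mu Apos x x0; have Mx0 : M *m x != 0.
  by apply: contraNneq x0 => Mx0; rewrite -(mulKmx Mu x) Mx0 mulmx0.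
by have := Apos _ Mx0; rewrite !innerE trmxC_mul !mulmxA.
Qed.

(** Congruence rather than similarity: [W] may be non-unitary, so the entries of [d] need not be
    eigenvalues, but one [W] can serve several non-commuting matrices. *)
Definition congr_diag n (W : 'M[C]_n) (d : 'rV[C]_n) : 'M[C]_n :=
  W ^t* *m diag_mx d *m W.

Lemma congr_diagB n (W : 'M[C]_n) (d e : 'rV[C]_n) :
  congr_diag W d - congr_diag W e = congr_diag W (d - e).
Proof. by rewrite /congr_diag raddfB /= mulmxBr mulmxBl. Qed.

Lemma congr_diagD n (W : 'M[C]_n) (d e : 'rV[C]_n) :
  congr_diag W d + congr_diag W e = congr_diag W (d + e).
Proof. by rewrite /congr_diag raddfD /= mulmxDr mulmxDl. Qed.

Lemma congr_diagZ n (W : 'M[C]_n) a (d : 'rV[C]_n) :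
  a *: congr_diag W d = congr_diag W (a *: d).
Proof. by rewrite /congr_diag linearZ /= -scalemxAr -scalemxAl. Qed.

Lemma trmxC_unit n (W : 'M[C]_n) : (W ^t* \in unitmx) = (W \in unitmx).
Proof. by rewrite map_unitmx unitmx_tr. Qed.

Lemma congr_diag_unit n (W : 'M[C]_n) (d : 'rV[C]_n) :
  W \in unitmx -> (forall i, d 0 i != 0) -> congr_diag W d \in unitmx.
Proof.
move=> Wu d0; rewrite !unitmx_mul trmxC_unit Wu andbT /=.
by rewrite unitmxE det_diag unitfE; apply/prodf_neq0 => i _.
Qed.

(** Inverting the middle factor produces the inverses of [W] and [W ^t*] that cancel the adjacent
    factors, so the triple product stays in the family attached to [W]. *)
Lemma congr_diag_mul_inv n (W : 'M[C]_n) (d e f : 'rV[C]_n) :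
  W \in unitmx -> (forall i, e 0 i != 0) ->
  congr_diag W d *m invmx (congr_diag W e) *m congr_diag W f =
  congr_diag W (\row_i (d 0 i / e 0 i * f 0 i)).
Proof.
move=> Wu e0; have Wu' : W ^t* \in unitmx by rewrite trmxC_unit.
have Eu := congr_diag_unit Wu e0.
pose g : 'rV[C]_n := \row_i (f 0 i / e 0 i).
(* Factoring the middle matrix out of the last one cancels its inverse without computing it. *)
have -> : congr_diag W f = congr_diag W e *m (invmx W *m diag_mx g *m W).
  rewrite /congr_diag !mulmxA mulmxK // -[in RHS](mulmxA _ (diag_mx e)).
  rewrite mulmx_diag; congr (_ *m diag_mx _ *m _).
  by apply/rowP => i; rewrite !mxE mulrC divfK.
rewrite mulmxA mulmxKV // /congr_diag !mulmxA mulmxK //.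
rewrite -[in LHS](mulmxA _ (diag_mx d)) mulmx_diag.
by congr (_ *m diag_mx _ *m _); apply/rowP => i; rewrite !mxE mulrCA mulrC.
Qed.

Lemma inner_congr_diag n (W : 'M[C]_n) (d : 'rV[C]_n) x (y := W *m x) :
  inner (congr_diag W d *m x) x = \sum_i d 0 i * (y i 0 * (y i 0)^*).
Proof.
rewrite innerE /congr_diag !mulmxA -trmxC_mul -mulmxA -/y mul_mx_diag mxE.
by apply: eq_bigr => i _; rewrite !mxE; ring.
Qed.

(** The form of the difference at [x] is the sum of the [|(W x)_i|^2] with weights [e_i - d_i]. This
    carries scalar inequalities over to matrices. *)
Lemma loewner_le_congr_diag n (W : 'M[C]_n) (d e : 'rV[C]_n) :
  (forall i, d 0 i <= e 0 i) ->
  loewner_le (congr_diag W d) (congr_diag W e).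
Proof.
move=> le_de x; rewrite congr_diagB inner_congr_diag.
apply: sumr_ge0 => i _; rewrite mulr_ge0 ?mul_conjC_ge0 //.
by rewrite !mxE subr_ge0.
Qed.

(** The form takes the value [d_i] at the preimage under [W] of the [i]-th basis vector. *)
Lemma posdefmx_congr_diag n (W : 'M[C]_n) (d : 'rV[C]_n) i :
  W \in unitmx -> posdefmx (congr_diag W d) -> 0 < d 0 i.
Proof.
move=> Wu Dpos; have v0 : invmx W *m delta_mx i (0 : 'I_1) != 0.
  apply/eqP => /(congr1 (mulmx W)); rewrite mulKVmx // mulmx0.
  by move/matrixP/(_ i 0); rewrite !mxE !eqxx => /eqP; rewrite oner_eq0.
have := Dpos _ v0; rewrite inner_congr_diag mulKVmx // (bigD1 i) //= big1.
  by rewrite !mxE !eqxx conjC1 !mulr1 addr0.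
by move=> j ji; rewrite !mxE (negPf ji) mul0r mulr0.
Qed.

(** A Hermitian matrix is normal, so the spectral theorem applies; unitarity turns the similarity
    into a congruence. *)
Lemma posdefmx_spectral n (A : 'M[C]_n) : posdefmx A ->
  A = congr_diag (spectralmx A) (spectral_diag A)
  /\ forall i, 0 < spectral_diag A 0 i.
Proof.
move=> Apos; have Au := spectral_unitarymx A.
have AE : A = congr_diag (spectralmx A) (spectral_diag A).
  rewrite /congr_diag -invmx_unitary //; apply/orthomx_spectralP.
  by apply/normalmxP; rewrite posdefmx_hermitian.
split=> // i; apply: (@posdefmx_congr_diag _ (spectralmx A)).
  exact: spectral_unit.
by rewrite -AE.
Qed.

Lemma sqrtmxE n (A : 'M[C]_n) :
  sqrtmx A = congr_diag (spectralmx A) (map_mx sqrtC (spectral_diag A)).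
Proof. by rewrite /sqrtmx invmx_unitary // spectral_unitarymx. Qed.

Lemma sqrtmx_posdef n (A : 'M[C]_n) : posdefmx A ->
  [/\ (sqrtmx A) ^t* = sqrtmx A, sqrtmx A *m sqrtmx A = A
    & sqrtmx A \in unitmx].
Proof.
move=> /posdefmx_spectral[AE dpos]; set P := spectralmx A in AE.
have Pu : P \in unitmx := spectral_unit A.
have PP : P *m P ^t* = 1%:M by apply/unitarymxP/spectral_unitarymx.
rewrite sqrtmxE -/P; split.
- rewrite /congr_diag !trmxC_mul trmxCK mulmxA tr_diag_mx map_diag_mx.
  congr (_ *m diag_mx _ *m _); apply/rowP => i; rewrite !mxE.
  by apply/CrealP/sqrtC_real/ltW.
- rewrite [RHS]AE /congr_diag !mulmxA -(mulmxA _ P) PP mulmx1.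
  rewrite -(mulmxA (P ^t*)) mulmx_diag; congr (_ *m diag_mx _ *m _).
  by apply/rowP => i; rewrite !mxE -expr2 sqrtCK.
- by apply: congr_diag_unit => // i; rewrite mxE sqrtC_eq0 gt_eqF.
Qed.

Lemma posdefmx_simultaneous_congr n (A B : 'M[C]_n) :
  posdefmx A -> posdefmx B ->
  exists W : 'M[C]_n, exists h : 'rV[C]_n,
    [/\ W \in unitmx, forall i, 0 < h 0 i, A = congr_diag W (const_mx 1),
        B = congr_diag W (\row_i h 0 i ^+ 2)
      & geom_mean A B = congr_diag W h].
Proof.
rewrite /geom_mean /= => /sqrtmx_posdef[].
(* From here on [S] is any invertible Hermitian square root of [A]. *)
move: (sqrtmx A) => S Sh SS Su Bpos.
have Vh : (invmx S) ^t* = invmx S by rewrite trmx_inv map_invmx Sh.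
have : posdefmx (invmx S *m B *m invmx S).
  by rewrite -{1}Vh; apply: posdefmx_congr; rewrite ?unitmx_inv.
rewrite sqrtmxE; set T := invmx S *m B *m invmx S.
move=> /posdefmx_spectral[TE dpos]; set P := spectralmx T in TE *.
have Pu : P \in unitmx := spectral_unit T.
have PP : P ^t* *m P = 1%:M.
  by rewrite -invmx_unitary ?mulVmx // spectral_unitarymx.
have congrS d : S *m congr_diag P d *m S = congr_diag (P *m S) d.
  by rewrite /congr_diag trmxC_mul Sh !mulmxA.
exists (P *m S), (map_mx sqrtC (spectral_diag T)); split.
- by rewrite unitmx_mul Pu.
- by move=> i; rewrite mxE sqrtC_gt0.
- by rewrite -congrS /congr_diag diag_const_mx mulmx1 PP mulmx1 SS.
- have -> : B = S *m T *m S by rewrite /T !mulmxA mulmxV // mul1mx mulmxKV.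
  rewrite {1}TE congrS; congr congr_diag.
  by apply/rowP => i; rewrite !mxE sqrtCK.
- by rewrite congrS.
Qed.

Lemma arith_geom_lower (h : C) : 0 < h ->
  8^-1 * ((1 - h ^+ 2) / (2^-1 * (1 + h ^+ 2)) * (1 - h ^+ 2))
  <= 2^-1 * (1 + h ^+ 2) - h.
Proof.
move=> h0; have q0 : 0 < 1 + h ^+ 2 by rewrite addr_gt0 ?exprn_gt0.
rewrite -subr_ge0.
have -> : 2^-1 * (1 + h ^+ 2) - h
    - 8^-1 * ((1 - h ^+ 2) / (2^-1 * (1 + h ^+ 2)) * (1 - h ^+ 2))
  = (1 - h) ^+ 4 / (4 * (1 + h ^+ 2)).
  by field; rewrite gt_eqF.
apply: divr_ge0; last by rewrite mulr_ge0 ?ler0n ?ltW.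
(* An even power in [C] is nonnegative here because [1 - h] is real. *)
by rewrite real_exprn_even_ge0 // rpredB ?real1 ?gtr0_real.
Qed.

Lemma arith_geom_upper (h : C) : 0 < h ->
  2^-1 * (1 + h ^+ 2) - h <= 8^-1 * ((1 - h ^+ 2) / h * (1 - h ^+ 2)).
Proof.
move=> h0; rewrite -subr_ge0.
have -> : 8^-1 * ((1 - h ^+ 2) / h * (1 - h ^+ 2))
    - (2^-1 * (1 + h ^+ 2) - h) = (1 - h) ^+ 4 / (8 * h).
  by field; rewrite gt_eqF.
apply: divr_ge0; last by rewrite mulr_ge0 ?ler0n ?ltW.
by rewrite real_exprn_even_ge0 // rpredB ?real1 ?gtr0_real.
Qed.

Lemma loewner_arith_geom n (A B : 'M[C]_n) : posdefmx A -> posdefmx B ->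
  loewner_le (8^-1 *: ((A - B) *m invmx (arith_mean A B) *m (A - B)))
             (arith_mean A B - geom_mean A B) /\
  loewner_le (arith_mean A B - geom_mean A B)
             (8^-1 *: ((A - B) *m invmx (geom_mean A B) *m (A - B))).
Proof.
move=> Apos Bpos.
have [W [h [Wu h0 AE BE GE]]] := posdefmx_simultaneous_congr Apos Bpos.
rewrite GE /arith_mean AE BE congr_diagD congr_diagZ !congr_diagB.
(* The diagonal of the arithmetic mean, [(1 + h_i^2) / 2], is nonzero, as its inversion requires. *)
have m0 i : (2^-1 *: (const_mx 1 + \row_j h 0 j ^+ 2)) 0 i != 0 :> C.
  by rewrite !mxE mulf_neq0 ?invr_eq0 ?pnatr_eq0 // gt_eqF // addr_gt0
    ?exprn_gt0.
rewrite !congr_diag_mul_inv // => [|i]; last by rewrite gt_eqF.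
rewrite !congr_diagZ; split; apply: loewner_le_congr_diag => i; rewrite !mxE.
  exact: arith_geom_lower.
exact: arith_geom_upper.
Qed.

End Congruence.

Local Open Scope complex_scope.

Theorem theorem2p1 (R : realType) (n : nat) (A B : 'M[R[i]]_n) :
  posdefmx A -> posdefmx B ->
  loewner_le (8^-1 *: ((A - B) *m invmx (arith_mean A B) *m (A - B)))
             (arith_mean A B - geom_mean A B) /\
  loewner_le (arith_mean A B - geom_mean A B)
             (8^-1 *: ((A - B) *m invmx (geom_mean A B) *m (A - B))).
Proof. exact: loewner_arith_geom. Qed.
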